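(* Let $h:[0,\infty)\to[0,\infty)$ be continuous and increasing with $h(0)=0$ and $h(1)=1$. Consider the following statements: (1) $\limsup_{t\downarrow0}Y_t/h(t)=0$ a.s.; (2) $\limsup_{t\downarrow0}Y_t/h(t)<1$ a.s.; (3) $\Pi(\{(t,x):t\in(0,1],\,x\ge h(t)\})<\infty$; (4) $\displaystyle\int_{(0,1]\times(0,1)}\frac{x^2}{h(t)^2}\mathbf{1}_{\{2h(t)>x\}}\,\Pi(dt,dx)<\infty$; (5) $\displaystyle 2^n\int_{(0,h^{-1}(2^{-n})]\times (0,2^{-n})} x\,\mathbf{1}_{\{2h(t)>x\}}\, \Pi(dt,dx) \to 0$ as $n\to\infty$; (6) $\displaystyle\int_{(0,1]\times(0,1)}\frac{x}{h(t)}\mathbf{1}_{\{2h(t)>x\}}\,\Pi(dt,dx)<\infty$. Then the following implications hold: (a) (1) implies (2), and (2) implies (3); (b) (3), (4) and (5) together imply (1); (c) (6) implies both (4) and (5).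
   Context: $Y=(Y_t)_{t\ge0}$ is a pure-jump right-continuous non-decreasing additive process (i.e. with independent, possibly non-stationary, increments) with $Y_0=0$ a.s. and mean jump measure $\Pi(dt,dx)$ on $[0,\infty)\times(0,\infty)$; that is, $Y_t$ is the sum of its jumps up to time $t$, the jumps form a Poisson random measure with mean measure $\Pi$, and for all $t,u\ge0$, $\mathbb{E}[e^{-uY_t}]=\exp\big(-\int_{(0,\infty)}(1-e^{-ux})\,\Pi((0,t],dx)\big)$. ''Increasing'' means strictly increasing and $h^{-1}$ is the inverse of $h$. *)

(* Defs.v *)
From mathcomp Require Import all_boot all_order all_algebra.
From mathcomp Require Import all_classical all_reals all_analysis measurable_realfun.

Set Implicit Arguments.
Unset Strict Implicit.
Unset Printing Implicit Defensive.

Import Order.TTheory GRing.Theory Num.Theory.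
Import numFieldNormedType.Exports.

Local Open Scope classical_set_scope.
Local Open Scope ring_scope.

(* The product rule for the whole family gives it for every subfamily, since
   [B i] may be [setT]. *)
Definition mutually_independent (R : realType) (d d' : measure_display)
    (T : measurableType d) (S : measurableType d') (P : probability T R)
    (n : nat) (X : 'I_n -> T -> S) : Prop :=
  forall B : 'I_n -> set S, (forall i, measurable (B i)) ->
    P (\bigcap_(i in [set: 'I_n]) (X i @^-1` B i)) =
    (\prod_(i < n) P (X i @^-1` B i))%E.

(* A random measure on [E] is a kernel from the sample space to [E].
   The Poisson mass function is written out because [poisson_pmf 0 k] is 1 for
   every [k]; here a set of mean 0 gets the Dirac law at 0, as 0 ^+ 0 = 1. *)
Record poisson_random_measure (R : realType) (d d' : measure_display)
    (T : measurableType d) (E : measurableType d') (P : probability T R)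
    (N : R.-ker T ~> E) (m : {measure set E -> \bar R}) : Prop := {
  prm_finite : forall A : set E, measurable A -> (m A < +oo)%E ->
    forall k : nat, P [set w | N w A = (k%:R)%:E] =
      (fine (m A) ^+ k / (k`!)%:R * expR (- fine (m A)))%:E;
  prm_infinite : forall A : set E, measurable A -> m A = +oo%E ->
    {ae P, forall w, N w A = +oo%E};
  prm_independent : forall (n : nat) (A : 'I_n -> set E),
    (forall i, measurable (A i)) -> trivIset [set: 'I_n] A ->
    mutually_independent P (fun i w => N w (A i))
}.

Definition jump (R : realType) (y : R -> R) (t : R) : R :=
  y t - lim (y s @[s --> t^'-]).

Definition jump_measure (R : realType) (y : R -> R) (A : set (R * R))
    : \bar R :=
  @counting R R [set t : R | 0 < t /\ 0 < jump y t /\ A (t, jump y t)].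

(* The process is indexed by the whole of [R], but only times t >= 0 matter.
   [jump_measure] does not charge the complement of ]0, +oo[ x ]0, +oo[, so
   [additive_jumps] makes [Pi] vanish there: [Pi] is in effect a measure on
   [0, +oo[ x ]0, +oo[, without mass at time 0 because Y_0 = 0. *)
Record pure_jump_additive_process (R : realType) (d : measure_display)
    (T : measurableType d) (P : probability T R) (Y : R -> {RV P >-> R})
    (Pi : {measure set (R * R) -> \bar R}) : Prop := {
  additive_start : {ae P, forall w, Y 0 w = 0};
  additive_right_continuous :
    {ae P, forall w, forall t : R, 0 <= t -> Y s w @[s --> t^'+] --> Y t w};
  additive_nondecreasing :
    {ae P, forall w, forall s t : R, 0 <= s -> s <= t -> Y s w <= Y t w};
  additive_independent_increments : forall (n : nat) (t : nat -> R),
    0 <= t 0%N -> {homo t : i j / (i <= j)%N >-> i <= j} ->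
    mutually_independent P
      (fun (i : 'I_n) (w : T) => Y (t i.+1) w - Y (t i) w);
  additive_pure_jump :
    {ae P, forall w, forall t : R, 0 <= t ->
      (Y t w)%:E = (\esum_(s in `]0%R, t]) (jump (Y ^~ w) s)%:E)%E};
  additive_jumps : exists N : R.-ker T ~> (R * R)%type,
    poisson_random_measure P N Pi /\
    {ae P, forall w, forall A, measurable A ->
      N w A = jump_measure (Y ^~ w) A};
  additive_laplace : forall t u : R, 0 <= t -> 0 <= u ->
    ('E_P[fun w => (expR (- (u * Y t w)))%R] =
     expeR (- \int[Pi]_(z in `]0%R, t] `*` `]0%R, +oo[)
                (1 - expR (- (u * z.2)))%:E))%E
}.

Definition limsup_ratio (R : realType) (y h : R -> R) : \bar R :=
  limf_esup (fun t => (y t / h t)%:E) 0^'+.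

(* Inverse of h : [0, +oo[ -> [0, +oo[, with junk value 0 off the range. *)
Definition inv_on_nneg (R : realType) (h : R -> R) : R -> R :=
  'pinv_(fun=> 0) `[0, +oo[ h.

(* Main.v *)
Require Import Defs.
From mathcomp Require Import all_boot all_order all_algebra.
From mathcomp Require Import finmap ring lra.
From mathcomp Require Import all_classical all_reals all_analysis measurable_realfun.

(* Write N for the Poisson random measure of the jumps and t_n for h^-1(2^-n).
   If Pi {x >= h(t)} is infinite then so is N {x >= h(t)}, almost surely; since
   Y_1 is a finite sum of jumps, only finitely many of these jumps occur after
   any given positive time, so there are jumps with Y_t >= h(t) at arbitrarily
   small times, and the limsup is at least 1.
   If Pi {x >= h(t)} is finite then almost surely all jumps before some positive
   time satisfy x < h(t), so that for large n the path Y_(t_n) is bounded by Z_n,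
   the integral of x against N over {t <= t_n, x < h(t)}. Campbell's formulas
   bound the variance of Z_n by the integral of x^2 against Pi over that region,
   and as the sum of 4^n over {n | h(t) <= 2^-n} is at most 2 / h(t)^2, (4) makes
   the series of the variances of 2^n Z_n converge: 2^n (Z_n - E Z_n) tends to 0
   almost surely. By (5) 2^n E Z_n tends to 0, hence so does 2^n Y_(t_n), and
   monotonicity gives Y_t / h(t) -> 0. The last implication is domination of
   x^2 / h(t)^2 and of 2^n x by multiples of x / h(t). *)

Set Implicit Arguments.
Unset Strict Implicit.
Unset Printing Implicit Defensive.
Import Order.TTheory GRing.Theory Num.Theory.
Import numFieldNormedType.Exports.
Local Open Scope classical_set_scope.
Local Open Scope ring_scope.

(** * Poisson random variables *)

Lemma sum_poisson_weights (R : realType) (a : R) :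
  0 <= a -> (\sum_(0 <= k <oo) (a ^+ k / k`!%:R * expR (- a))%:E = 1)%E.
Proof.
move=> a0; rewrite [RHS](_ : _ = (expR (- a))%:E * (expR a)%:E)%E; last first.
  by rewrite -EFinM expRN mulVf ?gt_eqF ?expR_gt0.
under eq_eseriesr do rewrite mulrC EFinM.
rewrite nneseriesZl/=; last first.
  by move=> n _; rewrite lee_fin divr_ge0// exprn_ge0.
congr *%E; rewrite expRE -EFin_lim; last first.
  rewrite /pseries/=; under eq_fun do rewrite mulrC.
  exact: is_cvg_series_exp_coeff.
apply/congr_lim/funext => n/=; rewrite /pseries/= /series/= -sumEFin//.
by under eq_bigr do rewrite mulrC.
Qed.

Lemma poisson_weight_ge0 (R : realType) (a : R) (k : nat) :
  0 <= a -> 0 <= a ^+ k / k`!%:R * expR (- a).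
Proof. by move=> a0; rewrite mulr_ge0 ?expR_ge0// divr_ge0// exprn_ge0. Qed.

(** The term k = 0 vanishes and k / k! = 1 / (k - 1)! for the others, so a factor k is traded for a
    factor a and a shift of g. Used once this gives the mean of a Poisson variable, used twice its
    second moment. *)
Lemma poisson_weight_shift (R : realType) (a : R) (g : nat -> R) :
  0 <= a -> (forall k, 0 <= g k) ->
  (\sum_(0 <= k <oo) (k%:R * g k * (a ^+ k / k`!%:R * expR (- a)))%:E =
   a%:E * \sum_(0 <= k <oo) (g k.+1 * (a ^+ k / k`!%:R * expR (- a)))%:E)%E.
Proof.
move=> a0 g0.
have t0 k : (0 <= (k%:R * g k * (a ^+ k / k`!%:R * expR (- a)))%:E)%E.
  by rewrite lee_fin mulr_ge0 ?poisson_weight_ge0 ?mulr_ge0.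
rewrite nneseries_recl// mul0r mul0r add0e.
rewrite -(nneseries_addn 1)//.
rewrite -nneseriesZl; last first.
  by move=> k _; rewrite lee_fin mulr_ge0// poisson_weight_ge0.
apply: eq_eseriesr => k _; rewrite addn1 -EFinM; congr EFin.
rewrite factS natrM exprS.
have k0 : (k.+1%:R : R) != 0 by rewrite pnatr_eq0.
have f0 : (k`!%:R : R) != 0 by rewrite pnatr_eq0 -lt0n fact_gt0.
move: (_.+1%:R) (_`!%:R) (a ^+ k) k0 f0 => x y z x0 y0.
by field; rewrite x0 y0.
Qed.

Section poisson_variable.
Context (R : realType) (d : measure_display) (T : measurableType d)
  (P : probability T R) (X : T -> \bar R) (a : R).
Hypothesis mX : measurable_fun [set: T] X.
Hypothesis a0 : 0 <= a.
Hypothesis poissonX : forall k : nat,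
  P [set w | X w = k%:R%:E] = (a ^+ k / k`!%:R * expR (- a))%:E.

Let S k := [set w | X w = k%:R%:E].

Let mS k : measurable (S k).
Proof. by rewrite -[S k]setTI; exact: (mX measurableT (emeasurable_set1 _)). Qed.

Let tS : trivIset [set: nat] S.
Proof.
move=> i j _ _ [w [/= Xi Xj]]; apply/eqP; rewrite -(eqr_nat R).
by have [->] : (i%:R : R)%:E = j%:R%:E by rewrite -Xi -Xj.
Qed.

Let mUS : measurable (\bigcup_k S k). Proof. exact: bigcup_measurable. Qed.

Let PUS : P (~` \bigcup_k S k) = 0%E.
Proof.
rewrite probability_setC//; apply/eqP.
rewrite measure_bigcup//= (eq_eseriesl (Q := xpredT)) => [|k]; last by rewrite in_setT.
by under eq_eseriesr do rewrite poissonX; rewrite sum_poisson_weights// subee.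
Qed.

Lemma poisson_ae_nat : {ae P, forall w, exists k : nat, X w = k%:R%:E}.
Proof.
exists (~` \bigcup_k S k); split => //; first exact: measurableC.
by apply: subsetC => w [k _ Xk]; exists k.
Qed.

(** The Poisson weights sum to 1, so the level sets [S k] exhaust the space up to a null set and the
    integral splits over them. *)
Lemma integral_poisson (G : T -> \bar R) (g : nat -> R) :
  measurable_fun [set: T] G -> (forall w, 0 <= G w)%E ->
  (forall w k, X w = k%:R%:E -> G w = (g k)%:E) ->
  (\int[P]_w G w =
   \sum_(0 <= k <oo) (g k * (a ^+ k / k`!%:R * expR (- a)))%:E)%E.
Proof.
move=> mG G0 Gg.
rewrite (ge0_negligible_integral (measurableC mUS))// setTD setCK.
rewrite ge0_integral_bigcup//; last exact: measurable_funTS.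
apply: eq_eseriesr => k _.
rewrite (eq_integral (fun=> (g k)%:E)); last by move=> w /[!inE] /= /Gg.
by rewrite integral_cst// EFinM; congr (_ * _)%E; exact: poissonX.
Qed.

Hypothesis X0 : forall w, (0 <= X w)%E.

Lemma poisson_mean : (\int[P]_w X w = a%:E)%E.
Proof.
rewrite (integral_poisson (g := fun k => k%:R * 1))//; last first.
  by move=> w k ->; rewrite mulr1.
rewrite (poisson_weight_shift (g := fun=> 1))//.
by under eq_eseriesr do rewrite mul1r; rewrite sum_poisson_weights// mule1.
Qed.

Lemma poisson_second_moment : (\int[P]_w (X w * X w) = (a * a + a)%:E)%E.
Proof.
rewrite (integral_poisson (g := fun k => k%:R * k%:R))//; last 3 first.
- exact: emeasurable_funM.
- by move=> w; exact: mule_ge0.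
- by move=> w k ->.
rewrite (poisson_weight_shift (g := fun k => k%:R))//.
(* The shift has turned the factor k into k + 1. Splitting it as k * 1 + 1 leaves one term ready for
   a second shift and another that sums to 1. *)
under eq_eseriesr => k _.
  rewrite -addn1 natrD mulrDl mul1r EFinD -[X in (X * _)%R]mulr1; over.
rewrite nneseriesD//=; first last.
- by move=> k _ _; rewrite lee_fin poisson_weight_ge0.
- by move=> k _ _; rewrite lee_fin mulr_ge0 ?poisson_weight_ge0// mulr1.
rewrite sum_poisson_weights// (poisson_weight_shift (g := fun=> 1))//.
under eq_eseriesr do rewrite mul1r; rewrite sum_poisson_weights// mule1.
by rewrite -EFinD -EFinM mulrDr mulr1.
Qed.

End poisson_variable.

(** * Moments of Poisson random measures *)

Section poisson_random_measure_moments.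
Context (R : realType) (d d' : measure_display) (T : measurableType d)
  (E : measurableType d') (P : probability T R) (N : R.-ker T ~> E)
  (m : {measure set E -> \bar R}).
Hypothesis hN : poisson_random_measure P N m.
Local Open Scope ereal_scope.

Let mN (A : set E) : measurable A -> measurable_fun [set: T] (fun w => N w A).
Proof. exact: measurable_kernel. Qed.

Let fin_mean (A : set E) : m A < +oo -> (fine (m A))%:E = m A.
Proof. by move=> mA; rewrite fineK// ge0_fin_numE. Qed.

Let fine_mean_ge0 (A : set E) : (0 <= fine (m A))%R.
Proof. exact: fine_ge0. Qed.

Lemma prm_ae_nat (A : set E) : measurable A -> m A < +oo ->
  {ae P, forall w, exists k : nat, N w A = k%:R%:E}.
Proof.
move=> mA Afin.
exact: (poisson_ae_nat (mN mA) (fine_mean_ge0 A) (prm_finite hN mA Afin)).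
Qed.

(** If [m A] is infinite so is the left side, because [N w A] is then almost surely infinite. *)
Lemma prm_mean (A : set E) : measurable A -> \int[P]_w N w A = m A.
Proof.
move=> mA; have [Afin|] := ltP (m A) +oo.
  rewrite (poisson_mean (mN mA) (fine_mean_ge0 A) (prm_finite hN mA Afin))// ?fin_mean//.
rewrite leye_eq => /eqP Ainf.
rewrite (ge0_ae_eq_integral measurableT (g := cst +oo))//; last 3 first.
- exact: mN.
- by move=> w _; exact: leey.
- by apply: filterS (prm_infinite hN mA Ainf) => w /= -> _.
rewrite integral_cst// Ainf -[RHS]mule1; congr (_ * _).
exact: probability_setT.
Qed.

Let prm_square (A : set E) : measurable A -> m A < +oo ->
  \int[P]_w (N w A * N w A) = m A * m A + m A.
Proof.
move=> mA Afin.
rewrite (poisson_second_moment (mN mA) (fine_mean_ge0 A) (prm_finite hN mA Afin))//.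
by rewrite EFinD EFinM fin_mean.
Qed.

(* Polarization: [N A], [N B] and [N (A `|` B)] are Poisson variables, whose
   second moments determine that of the product; independence is not needed. *)
Let prm_product_disjoint (A B : set E) : measurable A -> measurable B ->
  m A < +oo -> m B < +oo -> A `&` B = set0 ->
  \int[P]_w (N w A * N w B) = m A * m B.
Proof.
move=> mA mB Afin Bfin AB0.
have mAB : measurable (A `|` B) by exact: measurableU.
have mUE (mu : {measure set E -> \bar R}) : mu (A `|` B) = mu A + mu B.
  by rewrite measureU.
have ABfin : m (A `|` B) < +oo by rewrite mUE lte_add_pinfty.
have := prm_square mAB ABfin.
under eq_integral => w _.
  rewrite mUE ge0_muleDl// !ge0_muleDr// addeACA [X in _ + X]addeC.
  rewrite [N w B * N w A]muleC.
  over.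
have mNN C D : measurable C -> measurable D ->
    measurable_fun [set: T] (fun w => N w C * N w D).
  by move=> mC mD; apply: emeasurable_funM; exact: mN.
rewrite /= !ge0_integralD//; last first.
- by apply: emeasurable_funD; exact: mNN.
- by move=> w _; rewrite adde_ge0// mule_ge0.
- by apply: emeasurable_funD; exact: mNN.
- by move=> w _; rewrite adde_ge0// mule_ge0.
all: try by move=> w _; rewrite mule_ge0.
all: try exact: mNN.
rewrite !prm_square// mUE -(fin_mean Afin) -(fin_mean Bfin).
(* The cross moment could be infinite a priori; the equation of second moments, finite on its right
   side, rules this out and then determines it. *)
have : 0 <= \int[P]_w (N w A * N w B).
  by apply: integral_ge0 => w _; rewrite mule_ge0.
case: (\int[P]_w _) => [x _|//|//].
rewrite -?EFinM -?EFinD -?EFinM -?EFinD => -[eqx]; congr EFin; lra.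
Qed.

(** Cut A and B along their intersection. Between distinct pieces the cross moments are products of
    means; only the second moment of the common piece contributes an extra term, its mean. *)
Lemma prm_product (A B : set E) : measurable A -> measurable B ->
  m A < +oo -> m B < +oo ->
  \int[P]_w (N w A * N w B) = m A * m B + m (A `&` B).
Proof.
move=> mA mB Afin Bfin.
have mAB : measurable (A `&` B) by exact: measurableI.
have mADB : measurable (A `\` B) by exact: measurableD.
have mBDA : measurable (B `\` A) by exact: measurableD.
have ABfin : m (A `&` B) < +oo by apply: le_lt_trans Afin; exact: measureIl.
have ADBfin : m (A `\` B) < +oo by apply: le_lt_trans Afin; apply: le_measure; rewrite ?inE.
have BDAfin : m (B `\` A) < +oo by apply: le_lt_trans Bfin; apply: le_measure; rewrite ?inE.
have AE (mu : {measure set E -> \bar R}) :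
    mu A = mu (A `&` B) + mu (A `\` B) by rewrite (measureDI mu mA mB) addeC.
have BE (mu : {measure set E -> \bar R}) :
    mu B = mu (A `&` B) + mu (B `\` A).
  by rewrite (measureDI mu mB mA) addeC setIC.
under eq_integral => w _.
  rewrite (AE (N w)) (BE (N w)) ge0_muleDl// !ge0_muleDr//; over.
have mNN C D : measurable C -> measurable D ->
    measurable_fun [set: T] (fun w => N w C * N w D).
  by move=> mC mD; apply: emeasurable_funM; exact: mN.
rewrite /= !ge0_integralD//; last first.
- by apply: emeasurable_funD; exact: mNN.
- by move=> w _; rewrite adde_ge0// mule_ge0.
- by apply: emeasurable_funD; exact: mNN.
- by move=> w _; rewrite adde_ge0// mule_ge0.
all: try by move=> w _; rewrite mule_ge0.
all: try exact: mNN.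
rewrite prm_square// !prm_product_disjoint//; last 3 first.
- by apply/seteqP; split=> x //= [[_ nBx] [/nBx]].
- by apply/seteqP; split=> x //= [[_ nBx] [_ /nBx]].
- by apply/seteqP; split=> x //= [[Ax _] [_ /(_ Ax)]].
rewrite (AE m) (BE m) -(fin_mean ABfin) -(fin_mean ADBfin) -(fin_mean BDAfin).
by rewrite -?EFinM -?EFinD -?EFinM -?EFinD; congr EFin; ring.
Qed.

End poisson_random_measure_moments.

(** * Campbell's formulas for integrals against a Poisson random measure *)

Section poisson_integrals.
Local Open Scope ereal_scope.

Lemma mule_sum_sum (R : realDomainType) (n : nat) (x y : 'I_n -> \bar R) :
  (forall i, 0 <= x i) -> (forall i, 0 <= y i) ->
  (\sum_(i < n) x i) * (\sum_(j < n) y j) =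
  \sum_(i < n) \sum_(j < n) x i * y j.
Proof.
move=> x0 y0; rewrite ge0_sume_distrl//; apply: eq_bigr => i _.
by rewrite ge0_sume_distrr.
Qed.

Lemma integral_sum_indic (R : realType) (d : measure_display)
    (E : measurableType d) (mu : {measure set E -> \bar R}) (n : nat)
    (a : 'I_n -> R) (A : 'I_n -> set E) :
  (forall i, 0 <= a i)%R -> (forall i, measurable (A i)) ->
  \int[mu]_x (\sum_(i < n) a i * \1_(A i) x)%:E = \sum_(i < n) (a i)%:E * mu (A i).
Proof.
move=> a0 mA.
under eq_integral do rewrite -sumEFin.
rewrite ge0_integral_sum//; last 2 first.
- move=> i; apply/measurable_EFinP; apply: measurable_funM => //.
- by move=> i x _; rewrite lee_fin mulr_ge0.
apply: eq_bigr => i _; under eq_integral do rewrite EFinM.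
rewrite ge0_integralZl_EFin//; first by rewrite integral_indic// setIT.
exact/measurable_EFinP.
Qed.

Lemma measurable_integral_kernel (R : realType) (d d' : measure_display)
    (T : measurableType d) (E : measurableType d') (N : R.-ker T ~> E)
    (f : E -> R) : measurable_fun [set: E] f -> (forall x, 0 <= f x)%R ->
  measurable_fun [set: T] (fun w => \int[N w]_x (f x)%:E).
Proof.
move=> mf f0; apply: measurable_fun_integral_kernel.
- by move=> U mU; exact: measurable_kernel.
- by move=> z; rewrite lee_fin.
- exact/measurable_EFinP.
Qed.

Section campbell.
Context (R : realType) (d d' : measure_display) (T : measurableType d)
  (E : measurableType d') (P : probability T R) (N : R.-ker T ~> E)
  (m : {measure set E -> \bar R}).
Hypothesis hN : poisson_random_measure P N m.

(** Both squares expand into double sums over pairs (i, j). By [prm_product] each pair contributes a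
    product of means and the mean of the intersection of [A i] and [A j]; the latter terms add up to
    the integral of f^2, a product of two indicators being that of the intersection. *)
Let prm_sum_second_moment (n : nat) (a : 'I_n -> R) (A : 'I_n -> set E) :
  (forall i, 0 <= a i)%R -> (forall i, measurable (A i)) ->
  (forall i, m (A i) < +oo) ->
  let f := (fun x => \sum_(i < n) a i * \1_(A i) x)%R in
  \int[P]_w ((\int[N w]_x (f x)%:E) * (\int[N w]_x (f x)%:E)) =
  (\int[m]_x (f x)%:E) * (\int[m]_x (f x)%:E) + \int[m]_x (f x * f x)%:E.
Proof.
move=> a0 mA Afin f.
have aN0 (mu : {measure set E -> \bar R}) i : 0 <= (a i)%:E * mu (A i).
  by rewrite mule_ge0// lee_fin.
under [LHS]eq_integral => w _.
  rewrite /f integral_sum_indic// mule_sum_sum//.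
  under eq_bigr do under eq_bigr do rewrite muleACA -EFinM.
  over.
have mNN i j : measurable_fun [set: T]
    (fun w => (a i * a j)%:E * (N w (A i) * N w (A j))).
  apply: emeasurable_funM => //; apply: emeasurable_funM; exact: measurable_kernel.
have NN0 i j w : 0 <= (a i * a j)%:E * (N w (A i) * N w (A j)).
  by rewrite !mule_ge0// lee_fin mulr_ge0.
have EZ i j : \int[P]_w ((a i * a j)%:E * (N w (A i) * N w (A j))) =
    ((a i)%:E * m (A i)) * ((a j)%:E * m (A j)) + (a i * a j)%:E * m (A i `&` A j).
  rewrite ge0_integralZl_EFin ?mulr_ge0//; last first.
    by apply: emeasurable_funM; exact: measurable_kernel.
  rewrite (prm_product hN)// muleDr ?ge0_adde_def ?inE ?mule_ge0//.
  by rewrite EFinM muleACA.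
rewrite /= ge0_integral_sum//; last 2 first.
- by move=> i; apply: emeasurable_sum.
- by move=> i w _; apply: sume_ge0.
under eq_bigr => i _.
  rewrite ge0_integral_sum//.
  under eq_bigr => j _.
    rewrite EZ.
    over.
  rewrite big_split/=; over.
rewrite /= big_split/= -mule_sum_sum//; congr (_ + _).
  by rewrite /f integral_sum_indic.
under [RHS]eq_integral => x _.
  rewrite EFinM /f -!sumEFin mule_sum_sum; last 2 first.
  - by move=> i; rewrite lee_fin mulr_ge0.
  - by move=> i; rewrite lee_fin mulr_ge0.
  under eq_bigr do under eq_bigr do
    rewrite -EFinM mulrACA -[(\1__ x * \1__ x)%R]/((\1__ \* \1__) x)%R -indicI EFinM.
  over.
have mI i j : measurable (A i `&` A j) by exact: measurableI.
have mF i j : measurable_fun [set: E] (fun x =>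
    (a i * a j)%:E * (\1_(A i `&` A j) x)%:E).
  by apply: emeasurable_funM => //; exact/measurable_EFinP.
have F0 i j x : 0 <= (a i * a j)%:E * (\1_(A i `&` A j) x)%:E.
  by rewrite mule_ge0// lee_fin ?mulr_ge0.
rewrite /= ge0_integral_sum//; last 2 first.
- by move=> i; apply: emeasurable_sum.
- by move=> i w _; apply: sume_ge0.
apply: eq_bigr => i _; rewrite ge0_integral_sum//; apply: eq_bigr => j _.
rewrite ge0_integralZl_EFin//; first by rewrite integral_indic// setIT.
- exact/measurable_EFinP.
- by rewrite mulr_ge0.
Qed.

Import HBNNSimple.

(** [prm_product] asks for sets of finite mean. Markov's inequality provides them: a nonzero value
    of g times the measure of its level set is at most the integral of g. *)
Let nnsfun_sum_indic (g : {nnsfun E >-> R}) :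
  \int[m]_x (g x)%:E < +oo ->
  exists n (a : 'I_n -> R) (A : 'I_n -> set E),
  [/\ forall i, (0 <= a i)%R, forall i, measurable (A i),
      forall i, m (A i) < +oo &
      forall x, g x = (\sum_(i < n) a i * \1_(A i) x)%R].
Proof.
move=> gfin; pose s := fset_set (range g).
have s0 (i : 'I_#|` s|) : (0 <= s`_i)%R.
  have : s`_i \in s by exact: mem_nth.
  by rewrite in_fset_set// inE => -[x _ <-].
(* The level set of the value 0 may have infinite measure. *)
pose A (i : 'I_#|` s|) := if s`_i == 0%R then set0 else g @^-1` [set s`_i].
exists #|`s|, (fun i => s`_i), A; split => //.
- by move=> i; rewrite /A; case: ifPn.
- move=> i; rewrite /A; case: ifPn => [_|si0]; first by rewrite measure0.
  have si_gt0 : (0 < s`_i)%R by rewrite lt_def si0 s0.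
  rewrite -(@lte_pmul2l _ (s`_i)%:E)// mulry gtr0_sg// mul1e.
  apply: le_lt_trans gfin.
  have mA' : measurable (g @^-1` [set s`_i]) by [].
  rewrite -[X in _ * m X]setIT -(integral_indic m measurableT mA').
  rewrite -ge0_integralZl_EFin ?(ltW si_gt0)//; last exact/measurable_EFinP.
  apply: ge0_le_integral => //.
  + by move=> x _; rewrite lee_fin mulr_ge0.
  + by apply: emeasurable_funM => //; exact/measurable_EFinP.
  + exact/measurable_EFinP.
  + move=> x _; rewrite -EFinM lee_fin indicE.
    case: (asboolP ((g @^-1` [set s`_i]) x)) => [gx|ngx].
      by rewrite mem_set// mulr1 gx.
    by rewrite memNset// mulr0.
- move=> x; rewrite [LHS](fimfunEord g x); apply: eq_bigr => i _.
  by rewrite /A; case: ifPn => // /eqP ->; rewrite !mul0r.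
Qed.

Section approximation.
Variable f : E -> R.
Hypothesis mf : measurable_fun [set: E] f.
Hypothesis f0 : forall x, (0 <= f x)%R.

Let mEf : measurable_fun [set: E] (EFin \o f). Proof. exact/measurable_EFinP. Qed.

Let g := nnsfun_approx measurableT mEf.

Let nd_g x (i j : nat) : (i <= j)%N -> (g i x <= g j x)%R.
Proof. by move=> ij; exact/lefP/nd_nnsfun_approx. Qed.

Let g_cvg x : (g k x)%:E @[k --> \oo] --> (f x)%:E.
Proof. by apply: cvg_nnsfun_approx => // y _; rewrite /= lee_fin. Qed.

Let g_le x k : (g k x <= f x)%R.
Proof.
rewrite -lee_fin -(cvg_lim _ (@g_cvg x))//.
apply: lime_ge; first by apply: cvgP; exact: g_cvg.
by exists k => // j /= kj; rewrite lee_fin; exact: nd_g.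
Qed.

Let mg k : measurable_fun [set: E] (fun x => (g k x)%:E).
Proof. exact/measurable_EFinP. Qed.

Let integral_nd (mu : {measure set E -> \bar R}) i j : (i <= j)%N ->
  \int[mu]_x (g i x)%:E <= \int[mu]_x (g j x)%:E.
Proof.
move=> ij; apply: ge0_le_integral => //.
- by move=> x _; rewrite lee_fin.
- by move=> x _; rewrite lee_fin; exact: nd_g.
Qed.

Let integral_cvg (mu : {measure set E -> \bar R}) :
  \int[mu]_x (g k x)%:E @[k --> \oo] --> \int[mu]_x (f x)%:E.
Proof.
rewrite [X in _ --> X](_ : _ = \int[mu]_x limn (fun k => (g k x)%:E)).
  apply: cvg_monotone_convergence => //.
  - by move=> k x _; rewrite lee_fin.
  - by move=> x _ i j ij; rewrite lee_fin; exact: nd_g.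
by apply: eq_integral => x _; apply/esym/cvg_lim => //; exact: g_cvg.
Qed.

Let integral_nnsfun_ge0 (mu : {measure set E -> \bar R}) k :
  0 <= \int[mu]_x (g k x)%:E.
Proof. by apply: integral_ge0 => x _; rewrite lee_fin. Qed.

(** For a simple function this is linearity and [prm_mean]; monotone convergence, under [N w], under
    P and under m, extends it to f, with infinite values allowed. *)
Lemma prm_integral_mean :
  \int[P]_w \int[N w]_x (f x)%:E = \int[m]_x (f x)%:E.
Proof.
transitivity (\int[P]_w limn (fun k => \int[N w]_x (g k x)%:E)).
  by apply: eq_integral => w _; apply/esym/cvg_lim => //; exact: integral_cvg.
rewrite monotone_convergence//; last 2 first.
- by move=> k; exact: measurable_integral_kernel.
- by move=> w _ i j; exact: integral_nd.
rewrite -(cvg_lim _ (@integral_cvg m))//; congr (limn _); apply/funext => k.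
pose s := fset_set (range (g k)).
have s0 (i : 'I_#|` s|) : (0 <= s`_i)%R.
  have : s`_i \in s by exact: mem_nth.
  by rewrite in_fset_set// inE => -[x _ <-].
have gE (mu : {measure set E -> \bar R}) : \int[mu]_x (g k x)%:E =
    \sum_(i < #|` s|) (s`_i)%:E * mu (g k @^-1` [set s`_i]).
  under eq_integral => x _ do rewrite (fimfunEord (g k) x).
  exact: integral_sum_indic.
under eq_integral do rewrite gE.
rewrite gE ge0_integral_sum//; last 2 first.
- by move=> i; apply: emeasurable_funM => //; exact: measurable_kernel.
- by move=> i w _; rewrite mule_ge0// lee_fin.
apply: eq_bigr => i _; rewrite ge0_integralZl_EFin//; last exact: measurable_kernel.
by rewrite (prm_mean hN).
Qed.

(** Monotone convergence is used on the left only: each simple [g k] satisfies the identity, whose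
    right side is at most that of f because [g k <= f]. The inequality suffices for a variance
    bound. *)
Lemma prm_integral_second_moment : \int[m]_x (f x)%:E < +oo ->
  \int[P]_w ((\int[N w]_x (f x)%:E) * (\int[N w]_x (f x)%:E)) <=
  (\int[m]_x (f x)%:E) * (\int[m]_x (f x)%:E) + \int[m]_x (f x * f x)%:E.
Proof.
move=> ffin.
pose q k w := \int[N w]_x (g k x)%:E.
have q2_cvg w : q k w * q k w @[k --> \oo] -->
    (\int[N w]_x (f x)%:E) * (\int[N w]_x (f x)%:E).
  apply: cvgeM; [|exact: integral_cvg|exact: integral_cvg].
  have : 0 <= \int[N w]_x (f x)%:E by apply: integral_ge0 => x _; rewrite lee_fin.
  case: (\int[N w]_x _) => //= r _.
rewrite [leLHS](_ : _ = \int[P]_w limn (fun k => q k w * q k w)); last first.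
  by apply: eq_integral => w _; apply/esym/cvg_lim => //; exact: q2_cvg.
have q2_nd w i j : (i <= j)%N -> q i w * q i w <= q j w * q j w.
  by move=> ij; apply: lee_pmul => //; rewrite ?integral_nd//; exact: integral_nnsfun_ge0.
have q2_ge0 k w : 0 <= q k w * q k w.
  by apply: mule_ge0; exact: integral_nnsfun_ge0.
have mq2 k : measurable_fun [set: T] (fun w => q k w * q k w).
  by apply: emeasurable_funM; exact: measurable_integral_kernel.
rewrite monotone_convergence//; last by move=> w _ i j; exact: q2_nd.
apply: lime_le.
  apply: ereal_nondecreasing_is_cvgn => i j ij; apply: ge0_le_integral => //.
  by move=> w _; exact: q2_nd.
apply: nearW => k.
have gf : \int[m]_x (g k x)%:E <= \int[m]_x (f x)%:E.
  apply: ge0_le_integral => //.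
  - by move=> x _; rewrite lee_fin.
  - by move=> x _; rewrite lee_fin.
have [n [a [A [a0 mA Afin gE]]]] := nnsfun_sum_indic (le_lt_trans gf ffin).
have := prm_sum_second_moment a0 mA Afin.
rewrite (_ : (fun x => \sum_(i < n) a i * \1_(A i) x)%R = g k :> (E -> R)).
  rewrite /= => ->; apply: leeD.
    by apply: lee_pmul => //; exact: integral_nnsfun_ge0.
  apply: ge0_le_integral => //.
  - by move=> x _; rewrite lee_fin mulr_ge0.
  - by apply/measurable_EFinP; exact: measurable_funM.
  - by apply/measurable_EFinP; exact: measurable_funM.
  - by move=> x _; rewrite lee_fin ler_pM.
by apply/funext => x; rewrite gE.
Qed.

End approximation.

End campbell.

Lemma ae_fin_num_of_integral (R : realType) (d : measure_display)
    (T : measurableType d) (mu : {measure set T -> \bar R}) (X : T -> \bar R) :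
  measurable_fun [set: T] X -> (forall w, 0 <= X w) -> \int[mu]_w X w < +oo ->
  {ae mu, forall w, X w \is a fin_num}.
Proof.
move=> mX X0 Xfin.
have iX : mu.-integrable [set: T] X.
  apply/integrableP; split => //.
  by under eq_integral do rewrite gee0_abs//.
by apply: filterS (integrable_ae measurableT iX) => w; exact.
Qed.

(** * Variance and almost sure convergence of Poisson integrals *)

Section poisson_integral_cvg.
Context (R : realType) (d d' : measure_display) (T : measurableType d)
  (E : measurableType d') (P : probability T R) (N : R.-ker T ~> E)
  (m : {measure set E -> \bar R}).
Hypothesis hN : poisson_random_measure P N m.

Let integral_f_ge0 (f : E -> R) (mu : {measure set E -> \bar R}) :
  (forall x, 0 <= f x)%R -> 0 <= \int[mu]_x (f x)%:E.
Proof. by move=> f0; apply: integral_ge0 => x _; rewrite lee_fin. Qed.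

Lemma prm_integral_ae_fin (f : E -> R) : measurable_fun [set: E] f ->
  (forall x, 0 <= f x)%R -> \int[m]_x (f x)%:E < +oo ->
  {ae P, forall w, \int[N w]_x (f x)%:E \is a fin_num}.
Proof.
move=> mf f0 ffin; apply: ae_fin_num_of_integral.
- exact: measurable_integral_kernel.
- by move=> w; exact: integral_f_ge0.
- by rewrite (prm_integral_mean hN).
Qed.

Lemma prm_integral_variance (f : E -> R) : measurable_fun [set: E] f ->
  (forall x, 0 <= f x)%R -> \int[m]_x (f x)%:E < +oo ->
  \int[P]_w ((fine (\int[N w]_x (f x)%:E) - fine (\int[m]_x (f x)%:E)) ^+ 2)%:E
  <= \int[m]_x (f x * f x)%:E.
Proof.
move=> mf f0 ffin.
set M := fine _; pose Z w := \int[N w]_x (f x)%:E.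
have ME : \int[m]_x (f x)%:E = M%:E.
  by rewrite fineK// ge0_fin_numE// integral_f_ge0.
have M0 : (0 <= M)%R by rewrite fine_ge0// integral_f_ge0.
have Z0 w : 0 <= Z w by exact: integral_f_ge0.
have mZ : measurable_fun [set: T] Z by exact: measurable_integral_kernel.
have mV : measurable_fun [set: T] (fun w => ((fine (Z w) - M) ^+ 2)%:E).
  apply/measurable_EFinP; apply: measurable_funX; apply: measurable_funB => //.
  exact: measurableT_comp.
have EZ : \int[P]_w Z w = M%:E by rewrite (prm_integral_mean hN).
(* Adding 2 M E Z = 2 M^2 to both sides replaces (Z - M)^2 by (Z - M)^2 + 2 M Z = Z^2 + M^2, so that
   only nonnegative functions are integrated. *)
rewrite -(@leeD2rE _ (2 * M * M)%:E)//.
have -> : (2 * M * M)%:E = \int[P]_w ((2 * M)%:E * Z w).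
  by rewrite ge0_integralZl_EFin ?mulr_ge0// EZ -EFinM.
rewrite -ge0_integralD//; last 3 first.
- by move=> w _; rewrite lee_fin sqr_ge0.
- by move=> w _; rewrite mule_ge0// lee_fin mulr_ge0.
- exact: emeasurable_funM.
(* The identity requires a finite Z, as [fine] sends +oo to 0; this holds almost surely. *)
rewrite (ge0_ae_eq_integral measurableT (g := fun w => Z w * Z w + (M * M)%:E)); first last.
- apply: filterS (prm_integral_ae_fin mf f0 ffin) => w; rewrite -/(Z w).
  by case: (Z w) => //= r _ _; rewrite -!EFinM -!EFinD; congr EFin; ring.
- by move=> w _; rewrite adde_ge0// ?mule_ge0// lee_fin mulr_ge0.
- by move=> w _; rewrite adde_ge0// ?mule_ge0// lee_fin ?sqr_ge0// mulr_ge0.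
- by apply: emeasurable_funD => //; exact: emeasurable_funM.
- by apply: emeasurable_funD => //; exact: emeasurable_funM.
rewrite ge0_integralD//; last 3 first.
- by move=> w _; rewrite mule_ge0.
- exact: emeasurable_funM.
- by move=> w _; rewrite lee_fin mulr_ge0.
rewrite integral_cst// [X in (M * M)%:E * X](_ : _ = 1) ?mule1; last first.
  exact: probability_setT.
rewrite ge0_integralZl_EFin ?mulr_ge0// EZ.
apply: le_trans (leeD (prm_integral_second_moment hN mf f0 ffin) (lexx _)) _.
rewrite ME -!EFinM addeAC -EFinD addeC leeD2l// lee_fin.
by lra.
Qed.

(** The series of the squared deviations has an expectation at most the sum of the variance bounds.
    It is therefore almost surely finite, and its terms tend to 0. *)
Lemma prm_integral_centered_cvg (f : nat -> E -> R) :
  (forall n, measurable_fun [set: E] (f n)) -> (forall n x, 0 <= f n x)%R ->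
  (forall n, \int[m]_x (f n x)%:E < +oo) ->
  \sum_(0 <= n <oo) \int[m]_x (f n x * f n x)%:E < +oo ->
  {ae P, forall w, (fine (\int[N w]_x (f n x)%:E) - fine (\int[m]_x (f n x)%:E))%R
     @[n --> \oo] --> (0 : R)%R}.
Proof.
move=> mf f0 ffin vfin.
pose V n w := ((fine (\int[N w]_x (f n x)%:E) - fine (\int[m]_x (f n x)%:E)) ^+ 2)%R.
have V0 n w : (0 <= V n w)%R by exact: sqr_ge0.
have mV n : measurable_fun [set: T] (EFin \o V n).
  apply/measurable_EFinP; apply: measurable_funX; apply: measurable_funB => //.
  by apply: measurableT_comp => //; exact: measurable_integral_kernel.
have mS : measurable_fun [set: T] (fun w => \sum_(0 <= n <oo) (V n w)%:E).
  apply: ge0_emeasurable_sum => //.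
  - by move=> n w _ _; rewrite lee_fin.
  - by move=> n _; exact: mV.
have S0 w : 0 <= \sum_(0 <= n <oo) (V n w)%:E.
  by apply: nneseries_ge0 => n _ _; rewrite lee_fin.
have Sfin : \int[P]_w (\sum_(0 <= n <oo) (V n w)%:E) < +oo.
  rewrite integral_nneseries//; last by move=> n w _; rewrite lee_fin.
  apply: (le_lt_trans _ vfin); apply: lee_nneseries => [n _ _|n _].
    by apply: integral_ge0 => w _; rewrite lee_fin.
  exact: prm_integral_variance.
apply: filterS (ae_fin_num_of_integral mS S0 Sfin) => w /=.
rewrite ge0_fin_numE// => /(nnseries_is_cvg (V0^~ w)) /cvg_series_cvg_0 V_cvg.
apply: norm_cvg0.
rewrite [X in X @ _ --> _](_ : _ = Num.sqrt \o (V ^~ w)); last first.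
  by apply/funext => n; rewrite /= sqrtr_sqr.
rewrite -(sqrtr0 R); apply: cvg_comp V_cvg _; exact: sqrt_continuous.
Qed.

End poisson_integral_cvg.

End poisson_integrals.

(** * Jumps of a monotone path and the gauge function *)

(** Applied to the times of the jumps above the gauge, this yields a time before which there are
    none. *)
Lemma finite_set_pos_lbound (R : realDomainType) (S : set R) :
  finite_set S -> (forall x, S x -> 0 < x) ->
  exists2 e : R, 0 < e & forall x, S x -> e <= x.
Proof.
move=> /finite_seqP[s ->] s0.
elim: s s0 => [_|x s IH s0]; first by exists 1.
have [|e e0 se] := IH; first by move=> y ys; apply: s0; rewrite /= inE ys orbT.
exists (Num.min x e).
  by rewrite lt_min e0 s0//= mem_head.
by move=> y /=; rewrite inE ge_min => /predU1P[->|/se ->]; rewrite ?lexx ?orbT.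
Qed.

Section jumps.
Context (R : realType) (y : R -> R).
Hypothesis y0 : y 0 = 0.
Hypothesis nd_y : forall s t, 0 <= s -> s <= t -> y s <= y t.

Lemma jump_bounds (t : R) : 0 < t -> 0 <= jump y t <= y t.
Proof.
move=> t0; have y_cvg : cvg (y s @[s --> t^'-]).
  apply: nondecreasing_at_left_is_cvgr.
    near=> x => u v; rewrite !in_itv/= => /andP[xu _] _; apply: nd_y.
    by apply: ltW; apply: lt_trans xu; near: x; exact: nbhs_left_gt.
  near=> x; exists (y t) => _ [u + <-] /=; rewrite /= in_itv/= => /andP[xu ut].
  apply: nd_y (ltW ut); apply: ltW; apply: lt_trans xu.
  by near: x; exact: nbhs_left_gt.
rewrite /jump subr_ge0 gerBl; apply/andP; split.
  apply: limr_le => //; near=> s; apply: nd_y.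
    by near: s; exact: nbhs_left_ge.
  by apply: ltW; near: s; exact: nbhs_left_lt.
apply: limr_ge => //; near=> s; rewrite -y0; apply: nd_y => //.
by near: s; exact: nbhs_left_ge.
Unshelve. all: by end_near. Qed.

Variable mu : {measure set (R * R) -> \bar R}.
Hypothesis mu_jump : forall A, measurable A -> mu A = jump_measure y A.

(** The points (t, jump y t) with t in s are distinct and [mu_jump] gives each of them mass 1, so
    the sum is the integral of f over these finitely many atoms. *)
Lemma sum_jumps_le_integral (s : seq R) (f : R * R -> R) : uniq s ->
  (forall t, t \in s -> 0 < t /\ 0 < jump y t) ->
  measurable_fun [set: R * R] f -> (forall z, 0 <= f z) ->
  ((\sum_(t <- s) f (t, jump y t))%:E <= \int[mu]_z (f z)%:E)%E.
Proof.
move=> us s0 mf f0.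
pose F t := [set (t, jump y t)].
have mF t : measurable (F t).
  rewrite (_ : F t = [set t] `*` [set jump y t]); first exact: measurableX.
  by apply/seteqP; split=> -[a b] /= [-> ->].
apply: (@le_trans _ _ (\int[mu]_(z in \big[setU/set0]_(t <- s) F t) (f z)%:E)%E);
    last first.
  apply: ge0_subset_integral => //.
  - by apply: bigsetU_measurable.
  - exact/measurable_EFinP.
  - by move=> z _; rewrite lee_fin.
rewrite ge0_integral_bigsetU//; last 3 first.
- by move=> i j _ _ [z [/= -> []]].
- by apply/measurable_EFinP; exact: measurable_funTS.
- by move=> z _; rewrite lee_fin.
rewrite -sumEFin big_seq [leRHS]big_seq; apply: lee_sum => t ts.
rewrite (eq_integral (fun=> (f (t, jump y t))%:E)); last by move=> z /[!inE] ->.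
rewrite integral_cst// mu_jump// /jump_measure.
rewrite (_ : [set _ | _] = [set t]); last first.
  apply/seteqP; split=> u /=; first by case=> _ [_ []].
  by move=> ->; have [] := s0 _ ts.
by rewrite /counting asboolT// fset_set1 cardfs1 mule1.
Qed.

Lemma finite_jumps (A : set (R * R)) : measurable A -> (mu A < +oo)%E ->
  finite_set [set t | 0 < t /\ 0 < jump y t /\ A (t, jump y t)].
Proof.
by move=> mA; rewrite mu_jump// /jump_measure /counting; case: asboolP.
Qed.

Hypothesis y_sum : forall t, 0 <= t ->
  (y t)%:E = (\esum_(s in `]0%R, t]) (jump y s)%:E)%E.

Lemma sum_jumps_le (s : seq R) (t : R) : uniq s ->
  (forall u, u \in s -> 0 < u <= t) -> 0 <= t ->
  \sum_(u <- s) jump y u <= y t.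
Proof.
move=> us st t0; rewrite -lee_fin y_sum// -sumEFin.
rewrite (fsbig_seq _ _ us).
apply: ereal_sup_ubound; exists [set` s] => //; split; first exact: finite_seq.
by move=> u /= /st; rewrite in_itv.
Qed.

(** By [y_sum] the value y t is a supremum of finite sums of jumps, and [sum_jumps_le_integral]
    bounds each of them. *)
Lemma path_le_integral (t : R) (f : R * R -> R) : 0 <= t ->
  measurable_fun [set: R * R] f -> (forall z, 0 <= f z) ->
  (forall s, 0 < s <= t -> 0 < jump y s -> jump y s <= f (s, jump y s)) ->
  ((y t)%:E <= \int[mu]_z (f z)%:E)%E.
Proof.
move=> t0 mf f0 jf; rewrite y_sum//; apply: ge_ereal_sup => _ [F [finF Ft] <-].
have [s0 [us Fs]] : exists s : seq R, uniq s /\ F = [set` s].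
  exists (fset_set F); split; first exact: fset_uniq.
  by rewrite fset_setK.
(* Times with a zero jump are split off: they add nothing to the sum and are not atoms of [mu]. *)
rewrite Fs -fsbig_seq// (bigID (fun u => 0 < jump y u))/=.
rewrite [X in (_ + X)%E]big1_seq ?adde0; last first.
  move=> u /andP[+ us0]; rewrite -leNgt => ju.
  have /Ft : F u by rewrite Fs.
  rewrite /= in_itv/= => /andP[u0 _].
  by congr EFin; apply/eqP; rewrite eq_le ju; case/andP: (jump_bounds u0).
have s0t u : u \in [seq u <- s0 | 0 < jump y u] -> 0 < u <= t /\ 0 < jump y u.
  rewrite mem_filter => /andP[ju us0]; split => //.
  have /Ft : F u by rewrite Fs.
  by rewrite /= in_itv.
rewrite -big_filter sumEFin.
apply: le_trans (sum_jumps_le_integral (s := [seq u <- s0 | 0 < jump y u]) _ _ mf f0).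
- rewrite lee_fin big_seq [leRHS]big_seq; apply: ler_sum => u /s0t[ut ju].
  exact: jf.
- exact: filter_uniq.
- by move=> u /s0t[/andP[]].
Qed.

End jumps.

Lemma at_right0_itv (R : realType) (V : set R) : (0 : R)^'+ V ->
  exists2 e : R, 0 < e & forall t, 0 < t < e -> V t.
Proof.
move=> [e /= e0 eV]; exists e => // t /andP[t0 te]; apply: eV => //=.
by rewrite sub0r normrN gtr0_norm.
Qed.

Section gauge.
Context (R : realType) (h : R -> R).
Hypothesis h_ge0 : forall t : R, 0 <= t -> 0 <= h t.
Hypothesis h_cont : {within `[0, +oo[, continuous h}.
Hypothesis h_incr : forall s t : R, 0 <= s -> s < t -> h s < h t.
Hypothesis h0 : h 0 = 0.
Hypothesis h1 : h 1 = 1.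

Lemma gauge_gt0 (t : R) : 0 < t -> 0 < h t.
Proof. by move=> t0; rewrite -h0 h_incr. Qed.

Lemma gauge_le (s t : R) : 0 <= s -> 0 <= t -> (h s <= h t) = (s <= t).
Proof.
move=> s0 t0; have [st|ts|->] := ltgtP s t; last by rewrite lexx.
- by rewrite ltW// h_incr.
- by apply/negbTE; rewrite -ltNge h_incr.
Qed.

Let tau n := inv_on_nneg h (2 ^- n).

(** The intermediate value theorem on [0, 1] puts 2^-n in the range of h, so [inv_on_nneg] does not
    return its default value here, and injectivity of h identifies it. *)
Lemma gauge_inv (n : nat) : [/\ 0 < tau n, tau n <= 1 & h (tau n) = 2 ^- n].
Proof.
have n0 : 0 < (2 : R) ^- n by rewrite invr_gt0 exprn_gt0.
have n1 : (2 : R) ^- n <= 1 by rewrite invf_le1 ?exprn_gt0// exprn_ege1// ler1n.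
have [||c] := @IVT R h 0 1 (2 ^- n) ler01.
- apply: continuous_subspaceW h_cont => x /=; rewrite !in_itv/= andbT.
  by case/andP.
- by rewrite h0 h1 min_l// max_r// ltW.
rewrite in_itv/= => /andP[c0 c1] hc.
have tauE : tau n = c.
  rewrite /tau /inv_on_nneg -hc pinvKV//; last by rewrite inE/= in_itv/= c0.
  move=> s t; rewrite !inE/= !in_itv/= !andbT => s0 t0 st.
  by apply/eqP; rewrite eq_le -(gauge_le s0 t0) -(gauge_le t0 s0) st lexx.
rewrite tauE; split => //; rewrite lt_def c0 andbT.
by apply: contraTneq n0 => c_eq0; rewrite -hc c_eq0 h0 ltxx.
Qed.

Lemma le_gauge_inv (n : nat) (t : R) : 0 <= t -> (t <= tau n) = (h t <= 2 ^- n).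
Proof. by move=> t0; have [/ltW ? _ <-] := gauge_inv n; rewrite gauge_le. Qed.

Lemma gauge_inv_small (e : R) : 0 < e -> \forall n \near \oo, tau n < e.
Proof.
move=> e0; have he : 0 < h e by exact: gauge_gt0.
have : (fun n => (2^-1 : R) ^+ n) @ \oo --> (0 : R).
  by apply: cvg_expr; rewrite ger0_norm// invf_lt1// ltr1n.
move=> /cvgrPdist_lt/(_ _ he); apply: filterS => n /=.
rewrite sub0r normrN ger0_norm ?exprn_ge0// exprVn => hn.
have [/ltW tau0 _ hE] := gauge_inv n.
by rewrite ltNge -(gauge_le (ltW e0) tau0) hE -ltNge.
Qed.

(** This places t in a dyadic block, above [tau k.+1] and up to [tau k]; k + 1 is the least index at
    which [tau] falls below t. *)
Lemma gauge_dyadic (n : nat) (t : R) : 0 < t -> t <= tau n ->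
  exists2 k, (n <= k)%N & t <= tau k /\ 2 ^- k.+1 < h t.
Proof.
move=> t0 tn; have := gauge_inv_small t0 => -[K _ tauK].
have exK : exists k, tau k < t by exists K; exact: (tauK K (leqnn K)).
case: (ex_minnP exK) => j tj jmin.
have nj : (n < j)%N.
  rewrite ltnNge; apply/negP => jn; move: tj; apply/negP; rewrite -leNgt.
  rewrite (le_gauge_inv _ (ltW t0)); rewrite (le_gauge_inv _ (ltW t0)) in tn.
  by apply: le_trans tn _; rewrite lef_pV2 ?posrE ?exprn_gt0// ler_eXn2l// ltr1n.
case: j => // k in tj jmin nj *.
exists k => //; split.
  by rewrite leNgt; apply/negP => /jmin; rewrite ltnn.
by rewrite ltNge -(le_gauge_inv _ (ltW t0)) -ltNge.
Qed.

(** On the dyadic block of index k monotonicity gives y t / h t <= 2^(k+1) y (tau k), so the values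
    at the times [tau k] control the ratio. *)
Lemma limsup_ratio_eq0 (y : R -> R) : (forall t, 0 <= t -> 0 <= y t) ->
  (forall s t, 0 <= s -> s <= t -> y s <= y t) ->
  2 ^+ n * y (tau n) @[n --> \oo] --> 0 -> limsup_ratio y h = 0%E.
Proof.
move=> y_ge0 nd_y /cvgrPdist_le y_cvg; apply/eqP; rewrite eq_le; apply/andP; split.
  apply/lee_addgt0Pr => e e0; rewrite add0e.
  (* Half of e absorbs the factor 2 between 2^-k and 2^-(k+1). *)
  have e20 : 0 < e / 2 by rewrite divr_gt0.
  have [n _ ny] := y_cvg (e / 2) e20.
  have [tau0 _ _] := gauge_inv n.
  apply: le_trans (_ : (ereal_sup ((fun t => (y t / h t)%:E) @` `]0%R, tau n[) <= _)%E).
    apply: ereal_inf_lbound; exists `]0%R, tau n[%classic => //.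
    near=> u; rewrite /= in_itv/=; apply/andP; split; near: u.
      exact: nbhs_right_gt.
    exact: nbhs_right_lt.
  apply: ge_ereal_sup => _ [t + <-]; rewrite /= in_itv/= => /andP[t0 tn].
  have [k nk [tk hk]] := gauge_dyadic t0 (ltW tn).
  rewrite lee_fin ler_pdivrMr ?gauge_gt0//.
  apply: le_trans (nd_y _ _ (ltW t0) tk) _.
  have [tauk0 _ _] := gauge_inv k.
  have yk0 := y_ge0 _ (ltW tauk0).
  have := ny k nk; rewrite /= sub0r normrN ger0_norm ?mulr_ge0 ?exprn_ge0// => yk.
  apply: le_trans (_ : e * 2 ^- k.+1 <= _); last by rewrite ler_pM2l// ltW.
  rewrite exprS invfM mulrA ler_pdivlMr ?exprn_gt0// mulrC.
  exact: yk.
(* Conversely the limsup is nonnegative: every right neighbourhood of 0 contains a point e / 2,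
   where the ratio is nonnegative. *)
apply: le_ereal_inf_tmp => _ [V V0 <-].
have [e e0 eV] := at_right0_itv V0.
have e20 : 0 < e / 2 by rewrite divr_gt0.
apply: le_trans (_ : ((y (e / 2) / h (e / 2))%:E <= _)%E).
  by rewrite lee_fin divr_ge0 ?y_ge0 ?h_ge0// ltW.
apply: ereal_sup_ubound; exists (e / 2) => //; apply: eV.
by rewrite e20/= ltr_pdivrMr// mulr2n mulrDr mulr1 ltrDr.
Unshelve. all: by end_near. Qed.

Lemma limsup_ratio_ge1 (y : R -> R) :
  (forall e, 0 < e -> exists2 t, 0 < t < e & h t <= y t) ->
  (1 <= limsup_ratio y h)%E.
Proof.
move=> yh; apply: le_ereal_inf_tmp => _ [V V0 <-].
have [e e0 eV] := at_right0_itv V0.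
have [t /andP[t0 te] ht] := yh e e0.
apply: le_trans (_ : ((y t / h t)%:E <= _)%E).
  by rewrite lee_fin ler_pdivlMr ?gauge_gt0// mul1r.
apply: ereal_sup_ubound; exists t => //; apply: eV.
by rewrite t0.
Qed.

End gauge.

(** If y stayed below h on ]0, e[, no time of A would be less than e, since y t is at least its jump
    at t. Infinitely many jumps of size at least h e up to time 1 would then exceed the finite value
    y 1. *)
Lemma infinite_jumps_near0 (R : realType) (y h : R -> R) (A : set R) :
  y 0 = 0 -> (forall s t, 0 <= s -> s <= t -> y s <= y t) ->
  (forall t, 0 <= t -> (y t)%:E = (\esum_(s in `]0%R, t]) (jump y s)%:E)%E) ->
  (forall s t : R, 0 <= s -> s < t -> h s < h t) -> h 0 = 0 ->
  infinite_set A -> (forall t, A t -> 0 < t <= 1 /\ h t <= jump y t) ->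
  forall e, 0 < e -> exists2 t, 0 < t < e & h t <= y t.
Proof.
move=> y0 nd_y y_sum h_incr h0 infA Ah e e0; apply: contrapT => no_t.
have A_ge t : A t -> e <= t /\ h e <= jump y t.
  move=> At; have [/andP[t0 t1] ht] := Ah t At.
  have et : e <= t.
    rewrite leNgt; apply/negP => te; apply: no_t; exists t; first by rewrite t0.
    by apply: le_trans ht _; case/andP: (jump_bounds y0 nd_y t0).
  split => //; apply: le_trans ht.
  by rewrite (gauge_le h_incr (ltW e0) (ltW t0)).
have he0 : 0 < h e by exact: gauge_gt0.
have [K yK] : exists K : nat, y 1 < K%:R * h e.
  exists (Num.Def.trunc (y 1 / h e)).+1.
  by rewrite -ltr_pdivrMr//; exact: truncnS_gt.
have [B BA KB] := infinite_set_fset K infA.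
have := @sum_jumps_le _ _ y_sum B 1 (finmap.fset_uniq B) _ ler01.
have BA' u : u \in finmap.enum_fset B -> A u by move=> uB; apply: BA.
move=> /(_ (fun u uB => (Ah u (BA' u uB)).1)).
apply/negP; rewrite -ltNge; apply: lt_le_trans yK _.
apply: (@le_trans _ _ ((size (finmap.enum_fset B))%:R * h e)).
  by rewrite ler_wpM2r ?ler_nat// ltW.
rewrite -sum1_size natr_sum mulr_suml big_seq [leRHS]big_seq.
by apply: ler_sum => u /BA'/A_ge[_]; rewrite mul1r.
Qed.

(** The nonzero terms are powers 4^n with 2^n <= 1 / c, and the last of them is at least the sum of
    the earlier ones. Hence twice the last one, at most 2 / c^2, bounds the sum. *)
Lemma sum_dyadic_sqr_le (R : realType) (c : R) (n0 K : nat) : 0 < c ->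
  \sum_(0 <= k < K) (2 ^+ (k + n0) * (c <= 2 ^- (k + n0))%R%:R) ^+ 2 <= 2 / c ^+ 2.
Proof.
move=> c0; elim: K => [|K IH].
  by rewrite big_geq// divr_ge0// exprn_ge0// ltW.
rewrite big_nat_recr//=; have [cK|_] := boolP (c <= 2 ^- (K + n0)); last first.
  by rewrite mulr0 expr0n addr0.
(* This crude geometric bound survives the induction since 4^M + 4^M <= 4^(M+1). *)
have geo M : \sum_(0 <= k < M) (2 ^+ (k + n0) * (c <= 2 ^- (k + n0))%R%:R) ^+ 2 <=
    (2 ^+ (M + n0) : R) ^+ 2.
  elim: M => [|M IHM]; first by rewrite big_geq// sqr_ge0.
  rewrite big_nat_recr//= addSn (exprS _ (M + n0)) [in leRHS]exprMn.
  apply: le_trans (lerD IHM (_ : _ <= (2 ^+ (M + n0)) ^+ 2)) _.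
    rewrite exprMn; apply: ler_piMr; first exact: sqr_ge0.
    by case: (c <= _); rewrite ?expr1n ?expr0n.
  have := sqr_ge0 (2 ^+ (M + n0) : R); lra.
have c_inv0 : 0 <= c^-1 by rewrite invr_ge0 ltW.
rewrite mulr1; apply: le_trans (lerD (geo K) (lexx _)) _.
rewrite -mulr2n -[_ *+ 2]mulr_natl ler_pM2l// -exprVn ler_pXn2r ?nnegrE ?exprn_ge0//.
by rewrite -[leLHS]invrK lef_pV2 ?posrE ?invr_gt0 ?exprn_gt0.
Qed.

Lemma integral_vanish (R : realType) (d : measure_display) (E : measurableType d)
    (mu : {measure set E -> \bar R}) (D : set E) (f : E -> \bar R) :
  (forall z, ~ D z -> f z = 0%E) ->
  (\int[mu]_(z in D) f z = \int[mu]_z f z)%E.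
Proof.
move=> f0; rewrite integral_mkcond; apply: eq_integral => z _.
by rewrite patchE; case: ifPn => // /negP; rewrite inE => /f0.
Qed.

(** * Regions of the jump space cut out by the gauge, and integrals over them *)

Section regions.
Context (R : realType) (h : R -> R).
Hypothesis h_ge0 : forall t : R, 0 <= t -> 0 <= h t.
Hypothesis h_cont : {within `[0, +oo[, continuous h}.
Hypothesis h_incr : forall s t : R, 0 <= s -> s < t -> h s < h t.
Hypothesis h0 : h 0 = 0.
Hypothesis h1 : h 1 = 1.

Let tau n := inv_on_nneg h (2 ^- n).

(* [h] is only controlled on [0, +oo[; [hp] is monotone on the whole line, hence
   measurable. *)
Let hp (t : R) := h (Num.max t 0).

Let hpE t : 0 <= t -> hp t = h t. Proof. by move=> t0; rewrite /hp max_l. Qed.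

Let measurable_hp : measurable_fun [set: R] hp.
Proof.
apply: nondecreasing_measurable => // s t st.
have m0 u : 0 <= Num.max u 0 :> R by rewrite le_max lexx orbT.
by rewrite /hp (gauge_le h_incr (m0 s) (m0 t)) ge_max !le_max st lexx !orbT.
Qed.

Let measurable_hp1 : measurable_fun [set: R * R] (fun z => hp z.1).
Proof. exact: measurableT_comp. Qed.

Let measurable_bool_set (b : R * R -> bool) : measurable_fun [set: R * R] b ->
  measurable [set z | b z].
Proof.
move=> mb; rewrite -[X in measurable X]setTI.
exact: (mb measurableT [set true]).
Qed.

Definition above_gauge : set (R * R) := [set z | 0 < z.1 <= 1 /\ h z.1 <= z.2].

Lemma measurable_above_gauge : measurable above_gauge.
Proof.
rewrite (_ : above_gauge = [set z | [&& 0 < z.1, z.1 <= 1 & hp z.1 <= z.2]]).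
  apply: measurable_bool_set; apply: measurable_and; last apply: measurable_and.
  - exact: measurable_fun_ltr.
  - exact: measurable_fun_ler.
  - exact: measurable_fun_ler.
apply/seteqP; split => -[t x] /=.
  by move=> [/andP[t0 ->] hx]; rewrite t0 (hpE (ltW t0)).
by move=> /and3P[t0 t1]; rewrite (hpE (ltW t0)) => hx; split; rewrite //= t0.
Qed.

Definition below_gauge (n : nat) : set (R * R) :=
  [set z | 0 < z.1 <= tau n /\ 0 < z.2 < h z.1].

Lemma measurable_below_gauge n : measurable (below_gauge n).
Proof.
rewrite (_ : below_gauge n =
    [set z | [&& 0 < z.1, z.1 <= tau n, 0 < z.2 & z.2 < hp z.1]]).
  apply: measurable_bool_set; apply: measurable_and; last apply: measurable_and;
    last apply: measurable_and.
  - exact: measurable_fun_ltr.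
  - exact: measurable_fun_ler.
  - exact: measurable_fun_ltr.
  - exact: measurable_fun_ltr.
apply/seteqP; split => -[t x] /=.
  by move=> [/andP[t0 tn] /andP[x0]]; rewrite (hpE (ltW t0)) t0 tn x0.
by move=> /and4P[t0 tn x0]; rewrite (hpE (ltW t0)) => hx; split; rewrite /= ?t0 ?x0.
Qed.


Let measurable_small_hp :
  measurable_fun [set: R * R] (\1_[set z | z.2 < 2 * hp z.1] : R * R -> R).
Proof.
apply: measurable_indic; apply: measurable_bool_set; apply: measurable_fun_ltr => //.
exact: measurable_funM.
Qed.

Let measurable_hpV : measurable_fun [set: R * R] (fun z => (hp z.1)^-1).
Proof.
(* On nonnegative numbers inversion is the real power of exponent -1, and real powers are
   measurable. *)
have hp0 t : 0 <= hp t by rewrite h_ge0// le_max lexx orbT.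
under eq_fun do rewrite -powR_inv1//.
exact: (measurableT_comp (measurable_powR _) measurable_hp1).
Qed.

Let small_hpE (z : R * R) : 0 <= z.1 ->
  \1_[set z : R * R | z.2 < 2 * h z.1] z = \1_[set z | z.2 < 2 * hp z.1] z :> R.
Proof.
move=> z0; rewrite !indicE; congr (_%:R); congr (nat_of_bool _).
by apply/idP/idP; rewrite !inE /= hpE.
Qed.

Let box_ge0 (a b : R) (z : R * R) : z \in `]0, a] `*` `]0, b[ ->
  0 <= z.1 /\ 0 <= z.2.
Proof.
rewrite inE => -[/=]; rewrite !in_itv/= => /andP[/ltW ? _] /andP[/ltW ? _].
by split.
Qed.

Let measurable_box (a b : R) :
  measurable (`]0, a]%classic `*` `]0, b[%classic : set (R * R)).
Proof. exact: measurableX. Qed.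

(** Times in the box are positive, and there h coincides with the measurable [hp]. The next two
    lemmas rest on the same substitution. *)
Lemma measurable_trunc_jump (a b : R) : measurable_fun (`]0, a] `*` `]0, b[)
  (fun z : R * R => (z.2 * \1_[set z : R * R | z.2 < 2 * h z.1] z)%:E).
Proof.
apply/measurable_EFinP.
apply: (eq_measurable_fun (fun z : R * R => z.2 * \1_[set z | z.2 < 2 * hp z.1] z)).
  by move=> z /box_ge0[z1 _] /=; rewrite small_hpE.
by apply: measurable_funTS; exact: measurable_funM.
Qed.

Lemma measurable_trunc_ratio (a b : R) : measurable_fun (`]0, a] `*` `]0, b[)
  (fun z : R * R => (z.2 / h z.1 * \1_[set z : R * R | z.2 < 2 * h z.1] z)%:E).
Proof.
apply/measurable_EFinP.
apply: (eq_measurable_fun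
    (fun z : R * R => z.2 / hp z.1 * \1_[set z | z.2 < 2 * hp z.1] z)).
  by move=> z /box_ge0[z1 _] /=; rewrite small_hpE// hpE.
by apply: measurable_funTS; apply: measurable_funM => //; exact: measurable_funM.
Qed.

Lemma measurable_trunc_ratio2 (a b : R) : measurable_fun (`]0, a] `*` `]0, b[)
  (fun z : R * R => (z.2 ^+ 2 / h z.1 ^+ 2 *
     \1_[set z : R * R | z.2 < 2 * h z.1] z)%:E).
Proof.
apply/measurable_EFinP.
apply: (eq_measurable_fun
    (fun z : R * R => (z.2 / hp z.1) ^+ 2 * \1_[set z | z.2 < 2 * hp z.1] z)).
  by move=> z /box_ge0[z1 _] /=; rewrite small_hpE// hpE// exprMn exprVn.
apply: measurable_funTS; apply: measurable_funM => //; apply: measurable_funX.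
exact: measurable_funM.
Qed.

Variable mu : {measure set (R * R) -> \bar R}.

(** The indicator forces x / h(t) < 2, so the square of this ratio is at most twice the ratio. *)
Lemma ratio_integral_ratio2 :
  (\int[mu]_(z in `]0%R, 1%R] `*` `]0%R, 1%R[)
     (z.2 / h z.1 * \1_[set z : R * R | (z.2 < 2 * h z.1)%R] z)%:E < +oo)%E ->
  (\int[mu]_(z in `]0%R, 1%R] `*` `]0%R, 1%R[)
     (z.2 ^+ 2 / h z.1 ^+ 2 *
      \1_[set z : R * R | (z.2 < 2 * h z.1)%R] z)%:E < +oo)%E.
Proof.
move=> fin6; apply: (@le_lt_trans _ _ (\int[mu]_(z in `]0%R, 1%R] `*` `]0%R, 1%R[)
    (2%:E * (z.2 / h z.1 * \1_[set z : R * R | (z.2 < 2 * h z.1)%R] z)%:E))%E).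
  apply: ge0_le_integral => //.
  - move=> z /mem_set/box_ge0[z1 z2]; rewrite lee_fin.
    by rewrite mulr_ge0// divr_ge0 ?exprn_ge0 ?h_ge0.
  - exact: measurable_trunc_ratio2.
  - by apply: emeasurable_funM => //; exact: measurable_trunc_ratio.
  - move=> z /mem_set/box_ge0[z1 z2]; rewrite -EFinM lee_fin indicE.
    have [|_] := boolP (z \in _); last by rewrite !mulr0.
    rewrite inE/= => zh; rewrite !mulr1 -exprVn -exprMn expr2.
    have hz : 0 < h z.1 by have := h_ge0 z1; lra.
    by rewrite ler_wpM2r ?divr_ge0 ?h_ge0// ler_pdivrMr// ltW.
rewrite ge0_integralZl_EFin//.
- by rewrite lte_mul_pinfty// lee_fin.
- move=> z /mem_set/box_ge0[z1 z2]; rewrite lee_fin.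
  by rewrite mulr_ge0// divr_ge0 ?h_ge0.
- exact: measurable_trunc_ratio.
Qed.

Let mean_box (n : nat) :=
  ((2 ^+ n)%:E * \int[mu]_(z in `]0%R, inv_on_nneg h (2 ^- n)] `*` `]0%R, (2 ^- n)%R[)
     (z.2 * \1_[set z : R * R | (z.2 < 2 * h z.1)%R] z)%:E)%E.

(** Dominated convergence on the fixed box of (6). Where t <= tau n one has 2^n <= 1 / h(t), so the
    integrand of (6) dominates; at a fixed point the sequence is eventually 0, as [tau n] drops
    below t. *)
Lemma ratio_integral_mean_cvg0 :
  (\int[mu]_(z in `]0%R, 1%R] `*` `]0%R, 1%R[)
     (z.2 / h z.1 * \1_[set z : R * R | (z.2 < 2 * h z.1)%R] z)%:E < +oo)%E ->
  mean_box @ \oo --> 0%E.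
Proof.
move=> fin6.
pose D := (`]0%R, 1%R]%classic `*` `]0%R, 1%R[%classic : set (R * R)).
pose B n := (`]0%R, tau n]%classic `*` `]0%R, (2 ^- n)%R[%classic : set (R * R)).
pose G n (z : R * R) :=
  ((2 ^+ n)%:E * (z.2 * \1_[set z : R * R | (z.2 < 2 * h z.1)%R] z)%:E)%E.
have BD n : B n `<=` D.
  have [_ tau1 _] := gauge_inv h_cont h_incr h0 h1 n.
  move=> z [/=]; rewrite !in_itv/= => /andP[z0 zt] /andP[x0 zn].
  split; rewrite /= in_itv/= ?z0 ?x0/=.
    exact: le_trans zt _.
  by apply: lt_le_trans zn _; rewrite invf_le1 ?exprn_gt0// exprn_ege1// ler1n.
have meanE n : mean_box n = (\int[mu]_(z in D) (G n \_ (B n)) z)%E.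
  rewrite /mean_box -ge0_integralZl_EFin//; last 2 first.
  - by move=> z /mem_set/box_ge0[z1 z2]; rewrite lee_fin mulr_ge0.
  - exact: measurable_trunc_jump.
  by rewrite -integral_mkcondr setIidr.
rewrite (_ : mean_box = fun n => (\int[mu]_(z in D) (G n \_ (B n)) z)%E); last first.
  exact/funext.
rewrite -(integral0 mu D).
have G0 n z : D z -> (0 <= G n z)%E.
  by move=> /mem_set/box_ge0[z1 z2]; rewrite mule_ge0// lee_fin ?mulr_ge0// exprn_ge0.
apply: (@dominated_cvg _ _ _ mu D _ _ _
  (fun z : R * R => (z.2 / h z.1 * \1_[set z : R * R | (z.2 < 2 * h z.1)%R] z)%:E)) => //.
- exact: measurable_box.
- move=> n; apply: (iffLR (measurable_restrict (G n) (measurable_box (tau n) _)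
    (measurable_box 1 1))).
  rewrite [X in measurable_fun X _](_ : _ = B n); last exact/setIidr/BD.
  by apply: emeasurable_funM => //; exact: measurable_trunc_jump.
- move=> z Dz; apply: cvg_near_cst.
  have z0 : 0 < z.1 by move: Dz => [/=]; rewrite in_itv/= => /andP[].
  have := gauge_inv_small h_cont h_incr h0 h1 z0; apply: filterS => n tz.
  rewrite patchE memNset// => -[/=]; rewrite in_itv/= => /andP[_ zt].
  by move: (lt_le_trans tz zt); rewrite ltxx.
- apply/integrableP; split; first exact: measurable_trunc_ratio.
  rewrite (eq_integral
    (fun z : R * R => (z.2 / h z.1 * \1_[set z : R * R | (z.2 < 2 * h z.1)%R] z)%:E))//.
  move=> z /box_ge0[z1 z2]; rewrite gee0_abs// lee_fin.
  by rewrite mulr_ge0// divr_ge0 ?h_ge0.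
- move=> n z Dz; have /box_ge0[z1 z2] := mem_set Dz.
  rewrite patchE; case: ifPn => [|_]; last first.
    by rewrite abse0 lee_fin mulr_ge0// divr_ge0 ?h_ge0.
  rewrite inE => -[/=]; rewrite in_itv/= => /andP[z0 zt] _.
  rewrite lee_fin ger0_norm ?mulr_ge0 ?exprn_ge0// mulrA ler_wpM2r// mulrC ler_wpM2l//.
  rewrite -[leLHS]invrK lef_pV2 ?posrE ?invr_gt0 ?exprn_gt0 ?(gauge_gt0 h_incr h0)//.
  by rewrite -(le_gauge_inv h_cont h_incr h0 h1 _ z1).
Qed.

(** The integrand of the variable Z_n. Cutting at h(t) instead of the 2 h(t) of (4) and (5)
    suffices, because jumps above the gauge are treated separately. *)
Definition small_jump (n : nat) (z : R * R) : R := z.2 * \1_(below_gauge n) z.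

Lemma small_jump_ge0 n z : 0 <= small_jump n z.
Proof.
rewrite /small_jump indicE; have [|_] := boolP (z \in _); last by rewrite mulr0.
by rewrite inE mulr1 => -[_ /andP[/ltW]].
Qed.

Lemma measurable_small_jump n : measurable_fun [set: R * R] (small_jump n).
Proof.
by apply: measurable_funM => //; apply: measurable_indic; exact: measurable_below_gauge.
Qed.

(** For 0 < t <= tau n, the condition x < h(t) implies both x < 2^-n and x < 2 h(t), so the region
    of [small_jump] lies in that of (5). *)
Lemma small_jump_mean_le n :
  ((2 ^+ n)%:E * \int[mu]_z (small_jump n z)%:E <= mean_box n)%E.
Proof.
apply: lee_wpmul2l; first by rewrite lee_fin exprn_ge0.
have sub z : below_gauge n z -> (`]0%R, tau n]%classic `*` `]0%R, (2 ^- n)%R[%classic) z.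
  move=> [z1 /andP[z2 zh]]; split; rewrite /= in_itv//= z2/=.
  apply: lt_le_trans zh _; case/andP: z1 => z1 zt.
  by rewrite -(le_gauge_inv h_cont h_incr h0 h1 _ (ltW z1)).
rewrite -(@integral_vanish _ _ _ mu
  (`]0%R, tau n]%classic `*` `]0%R, (2 ^- n)%R[%classic)); last first.
  by move=> z nz; rewrite /small_jump indicE memNset ?mulr0// => /sub.
apply: ge0_le_integral => //.
- by move=> z _; rewrite lee_fin small_jump_ge0.
- by apply: measurable_funTS; apply/measurable_EFinP; exact: measurable_small_jump.
- exact: measurable_trunc_jump.
- move=> z /mem_set/box_ge0[z1 z2]; rewrite lee_fin /small_jump ler_wpM2l//.
  rewrite [leLHS]indicE; have [|_] := boolP (z \in _); last by [].
  rewrite inE => -[/andP[z0 _] /andP[_ zh]]; rewrite indicE mem_set//=.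
  by have := gauge_gt0 h_incr h0 z0; lra.
Qed.

(** After exchanging sum and integral, [sum_dyadic_sqr_le] with c = h(t) applies at each point,
    since t <= tau n means h(t) <= 2^-n. The shift by n0 serves to discard the indices at which the
    mean of [small_jump] may be infinite. *)
Lemma small_jump_square_sum (n0 : nat) :
  (\sum_(0 <= k <oo) \int[mu]_z
     ((2 ^+ (k + n0) * small_jump (k + n0) z) * (2 ^+ (k + n0) * small_jump (k + n0) z))%:E <=
   2%:E * \int[mu]_(z in `]0%R, 1%R] `*` `]0%R, 1%R[)
     (z.2 ^+ 2 / h z.1 ^+ 2 *
      \1_[set z : R * R | (z.2 < 2 * h z.1)%R] z)%:E)%E.
Proof.
pose c k : R := 2 ^+ (k + n0).
pose D := (`]0%R, 1%R]%classic `*` `]0%R, 1%R[%classic : set (R * R)).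
have t0 k z : (0 <= ((c k * small_jump (k + n0) z) * (c k * small_jump (k + n0) z))%:E)%E.
  by rewrite lee_fin -expr2 sqr_ge0.
have mt k : measurable_fun [set: R * R]
    (fun z => ((c k * small_jump (k + n0) z) * (c k * small_jump (k + n0) z))%:E).
  have mk : measurable_fun [set: R * R] (fun z => c k * small_jump (k + n0) z).
    by apply: measurable_funM => //; exact: measurable_small_jump.
  by apply/measurable_EFinP; exact: measurable_funM.
rewrite -integral_nneseries//; last by move=> k z _; exact: t0.
rewrite -(@integral_vanish _ _ _ mu D); last first.
  move=> z nDz; apply: eseries0 => k _ _; rewrite /small_jump indicE memNset.
    by rewrite !mulr0.
  move=> [/andP[z1 zt] /andP[z2 zh]]; apply: nDz.
  have [_ tau1 _] := gauge_inv h_cont h_incr h0 h1 (k + n0).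
  have zt1 := le_trans zt tau1.
  split; rewrite /= in_itv/= ?z1// z2/=; apply: lt_le_trans zh _.
  by rewrite -h1 (gauge_le h_incr (ltW z1)).
rewrite -ge0_integralZl_EFin//; last 2 first.
- move=> z /mem_set/box_ge0[z1 z2]; rewrite lee_fin.
  by rewrite mulr_ge0// divr_ge0 ?exprn_ge0 ?h_ge0.
- exact: measurable_trunc_ratio2.
apply: ge0_le_integral => //.
- exact: measurable_box.
- by move=> z _; apply: nneseries_ge0 => k _ _; exact: t0.
- apply: measurable_funTS; apply: ge0_emeasurable_sum => [k z _ _|k _].
    exact: t0.
  exact: mt.
- by apply: emeasurable_funM => //; exact: measurable_trunc_ratio2.
move=> z Dz; have /box_ge0[z1 z2] := mem_set Dz.
have z0 : 0 < z.1 by move: Dz => [/=]; rewrite in_itv/= => /andP[].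
have hz := gauge_gt0 h_incr h0 z0.
apply: lime_le; first by apply: is_cvg_nneseries => k _ _; exact: t0.
apply: nearW => K; rewrite sumEFin -EFinM lee_fin.
set I := \1_ _ _.
have I0 : 0 <= I by [].
apply: (@le_trans _ _ (\sum_(0 <= k < K)
    z.2 ^+ 2 * I * (c k * (h z.1 <= 2 ^- (k + n0))%R%:R) ^+ 2)); last first.
  rewrite -mulr_sumr; apply: le_trans (ler_wpM2l _ (sum_dyadic_sqr_le n0 K hz)) _.
    by rewrite mulr_ge0 ?sqr_ge0.
  by rewrite le_eqVlt; apply/orP; left; apply/eqP; ring.
apply: ler_sum => k _; rewrite -expr2 /small_jump.
have [zB|zB] := boolP (z \in below_gauge (k + n0)); last first.
  by rewrite indicE (negbTE zB) !mulr0 expr0n/= mulr_ge0 ?sqr_ge0// mulr_ge0 ?sqr_ge0.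
have [/andP[_ zt] /andP[_ zh]] := set_mem zB.
rewrite indicE zB -(le_gauge_inv h_cont h_incr h0 h1 _ z1) zt.
by rewrite /I indicE mem_set/= ?mulr1 ?exprMn 1?mulrC//; lra.
Qed.

End regions.

(** * Almost sure behaviour of the paths near time 0 *)

Section theorem3p3_proof.
Context (R : realType) (d : measure_display) (T : measurableType d)
  (P : probability T R) (Y : R -> {RV P >-> R})
  (Pi : {measure set (R * R) -> \bar R}) (h : R -> R).
Hypothesis hY : pure_jump_additive_process Y Pi.
Hypothesis h_ge0 : forall t : R, 0 <= t -> 0 <= h t.
Hypothesis h_cont : {within `[0, +oo[, continuous h}.
Hypothesis h_incr : forall s t : R, 0 <= s -> s < t -> h s < h t.
Hypothesis h0 : h 0 = 0.
Hypothesis h1 : h 1 = 1.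

Let tau n := inv_on_nneg h (2 ^- n).

Let regular_path (N : R.-ker T ~> (R * R)%type) (w : T) :=
  [/\ Y 0 w = 0, forall s t : R, 0 <= s -> s <= t -> Y s w <= Y t w,
      forall t : R, 0 <= t ->
        (Y t w)%:E = (\esum_(s in `]0%R, t]) (jump (Y ^~ w) s)%:E)%E &
      forall A, measurable A -> N w A = jump_measure (Y ^~ w) A].

Let regular_paths : exists2 N : R.-ker T ~> (R * R)%type,
  poisson_random_measure P N Pi & {ae P, forall w, regular_path N w}.
Proof.
case: hY => start _ nd _ pj [N [hN jumps]] _; exists N => //.
by apply: filterS (filterI start (filterI nd (filterI pj jumps))) => w [? [? []]].
Qed.

Let above := above_gauge h.

Let m_above : measurable above. Proof. exact: measurable_above_gauge. Qed.

Lemma limsup_lt1_above_fin :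
  {ae P, forall w, (limsup_ratio (Y ^~ w) h < 1)%E} -> (Pi above < +oo)%E.
Proof.
move=> limsup_lt1; have [N hN reg] := regular_paths.
rewrite ltey; apply/eqP => Pi_inf.
(* Positive total mass makes the almost-everywhere filter proper, so that the three almost sure
   events below have a common point w. *)
have P0 : (0 < P [set: T])%E.
  by rewrite (_ : P [set: T] = 1%E) ?lte01//; exact: probability_setT.
have pf := ae_properfilter_algebraOfSetsType P0.
have [w [lim_w [[y0 nd_y y_sum N_jump] N_inf]]] := filter_ex
  (filterI limsup_lt1 (filterI reg (prm_infinite hN m_above Pi_inf))).
have := lim_w; apply/negP; rewrite -leNgt; apply: limsup_ratio_ge1 => //.
apply: (infinite_jumps_near0 (A := [set t | 0 < t /\ 0 < jump (Y ^~ w) t /\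
  above (t, jump (Y ^~ w) t)])) => //.
  move: N_inf; rewrite N_jump// /jump_measure /counting.
  by case: asboolP.
by move=> t [_ [_ [/= ? ?]]].
Qed.

Lemma above_fin_limsup_eq0 :
  (Pi above < +oo)%E ->
  (\int[Pi]_(z in `]0%R, 1%R] `*` `]0%R, 1%R[)
     (z.2 ^+ 2 / h z.1 ^+ 2 *
      \1_[set z : R * R | (z.2 < 2 * h z.1)%R] z)%:E < +oo)%E ->
  (fun n : nat => ((2 ^+ n)%:E *
    \int[Pi]_(z in `]0%R, inv_on_nneg h (2 ^- n)] `*` `]0%R, (2 ^- n)%R[)
      (z.2 * \1_[set z : R * R | (z.2 < 2 * h z.1)%R] z)%:E)%E) @ \oo --> 0%E ->
  {ae P, forall w, limsup_ratio (Y ^~ w) h = 0%E}.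
Proof.
move=> above_fin fin4 mean_cvg0; have [N hN reg] := regular_paths.
have scaledE (mu : {measure set (R * R) -> \bar R}) n :
    (\int[mu]_z (2 ^+ n * small_jump h n z)%:E =
     (2 ^+ n)%:E * \int[mu]_z (small_jump h n z)%:E)%E.
  under eq_integral do rewrite EFinM.
  rewrite ge0_integralZl_EFin//; first by move=> z _; rewrite lee_fin small_jump_ge0.
  by apply/measurable_EFinP; exact: measurable_small_jump.
pose mean n := (\int[Pi]_z (2 ^+ n * small_jump h n z)%:E)%E.
have mean_ge0 n : (0 <= mean n)%E.
  by apply: integral_ge0 => z _; rewrite lee_fin mulr_ge0 ?exprn_ge0 ?small_jump_ge0.
have mean_cvg : mean n @[n --> \oo] --> 0%E.
  apply: (squeeze_cvge _ (cvg_cst _) mean_cvg0); apply: nearW => n.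
  by rewrite mean_ge0/= /mean scaledE; exact: small_jump_mean_le.
(* Convergence to 0 in the extended reals makes the means finite only from some rank n0 on, whence
   the shift in f. *)
have [[n0 _ mean_fin] fine_mean_cvg] := (iffLR (fine_cvgP _ _)) mean_cvg.
pose f k z := 2 ^+ (k + n0) * small_jump h (k + n0) z.
have mf k : measurable_fun [set: R * R] (f k).
  by apply: measurable_funM => //; exact: measurable_small_jump.
have f0 k z : 0 <= f k z by rewrite mulr_ge0 ?exprn_ge0 ?small_jump_ge0.
have ffin k : (\int[Pi]_z (f k z)%:E < +oo)%E 
  by rewrite -ge0_fin_numE ?mean_ge0//; apply: mean_fin; exact: leq_addl.
have vfin : (\sum_(0 <= k <oo) \int[Pi]_z (f k z * f k z)%:E < +oo)%E.
  apply: le_lt_trans (small_jump_square_sum h_ge0 h_cont h_incr h0 h1 Pi n0) _.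
  by rewrite lte_mul_pinfty.
have mean_fine : fine (\int[Pi]_z (f k z)%:E) @[k --> \oo] --> (0 : R).
  by rewrite (cvg_shiftn n0 (fine \o mean)).
have centered := prm_integral_centered_cvg hN mf f0 ffin vfin.
have Nfin := ae_foralln (fun k => prm_integral_ae_fin hN (mf k) (f0 k) (ffin k)).
have above_nat := prm_ae_nat hN m_above above_fin.
apply: filterS (filterI reg (filterI centered (filterI Nfin above_nat))).
move=> w [[y0 nd_y y_sum N_jump] [centered_w [Nfin_w [k0 N_above]]]].
apply: limsup_ratio_eq0 => //; first by move=> t t0; rewrite -y0 nd_y.
(* The expected number of jumps above the gauge is finite, so on this path there are finitely many,
   and none of them before the time e. *)
have finS : finite_set [set t | 0 < t /\ 0 < jump (Y ^~ w) t /\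
    above (t, jump (Y ^~ w) t)].
  by apply: (finite_jumps N_jump) => //; rewrite N_above ltry.
have [e e0 eS] := finite_set_pos_lbound finS (fun t St => St.1).
(* The scaled Z_n is its centered part plus its mean, and both tend to 0. *)
have N_cvg : fine (\int[N w]_z (f k z)%:E) @[k --> \oo] --> (0 : R).
  rewrite (_ : (fun k => _) = (fun k => (fine (\int[N w]_z (f k z)%:E) -
      fine (\int[Pi]_z (f k z)%:E)) + fine (\int[Pi]_z (f k z)%:E))).
    by rewrite -[X in _ --> X](addr0 (0 : R)); exact: cvgD.
  by apply/funext => k; rewrite subrK.
rewrite -(cvg_shiftn n0).
apply: (squeeze_cvgr _ (cvg_cst _) N_cvg).
have tau_lt_e : \forall k \near \oo, tau (k + n0) < e.
  have := gauge_inv_small h_cont h_incr h0 h1 e0 => -[K _ HK].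
  by exists K => // k /= Kk; apply: HK; exact: leq_trans Kk (leq_addr _ _).
apply: filterS tau_lt_e => k tau_e.
have [tau0 tau1 _] := gauge_inv h_cont h_incr h0 h1 (k + n0).
rewrite mulr_ge0 ?exprn_ge0//=; last by rewrite -y0 nd_y// ltW.
(* By [Nfin_w] the integral is finite on this path, so [fine] does not alter it; what remains is to
   bound the path at [tau (k + n0)] by Z_n. *)
rewrite -lee_fin fineK// EFinM scaledE lee_wpmul2l ?lee_fin ?exprn_ge0//.
apply: (path_le_integral y0 nd_y N_jump y_sum (ltW tau0)).
- exact: measurable_small_jump.
- by move=> z; exact: small_jump_ge0.
(* A jump at s <= [tau (k + n0)] that reached h(s) would be one of the finitely many above the
   gauge, hence at time e or later, whereas [tau (k + n0) < e]. *)
move=> s /andP[s0 st] js; rewrite /small_jump indicE mem_set ?mulr1//.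
split; rewrite /= ?s0//= js ltNge; apply/negP => hs.
have : e <= s.
  apply: eS; split => //; split => //; split => //=.
  by rewrite s0 (le_trans st tau1).
by rewrite leNgt (le_lt_trans st tau_e).
Qed.

End theorem3p3_proof.

Theorem theorem3p3 (R : realType) (d : measure_display)
    (T : measurableType d) (P : probability T R)
    (Y : R -> {RV P >-> R}) (Pi : {measure set (R * R) -> \bar R})
    (hY : pure_jump_additive_process Y Pi)
    (h : R -> R)
    (h_ge0 : forall t : R, 0 <= t -> 0 <= h t)
    (h_cont : {within `[0, +oo[, continuous h})
    (h_incr : forall s t : R, 0 <= s -> s < t -> h s < h t)
    (h0 : h 0 = 0) (h1 : h 1 = 1) :
  let S1 := {ae P, forall w, limsup_ratio (Y ^~ w) h = 0%E} in
  let S2 := {ae P, forall w, (limsup_ratio (Y ^~ w) h < 1)%E} in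
  let S3 := (Pi [set z : R * R | (0 < z.1 <= 1)%R /\ (h z.1 <= z.2)%R] < +oo)%E in
  let S4 := (\int[Pi]_(z in `]0%R, 1%R] `*` `]0%R, 1%R[)
               (z.2 ^+ 2 / h z.1 ^+ 2 *
                \1_[set z : R * R | (z.2 < 2 * h z.1)%R] z)%:E < +oo)%E in
  let S5 := (fun n : nat => ((2 ^+ n)%:E *
               \int[Pi]_(z in `]0%R, inv_on_nneg h (2 ^- n)]
                              `*` `]0%R, (2 ^- n)%R[)
                 (z.2 * \1_[set z : R * R | (z.2 < 2 * h z.1)%R] z)%:E)%E)
            @ \oo --> 0%E in
  let S6 := (\int[Pi]_(z in `]0%R, 1%R] `*` `]0%R, 1%R[)
               (z.2 / h z.1 *
                \1_[set z : R * R | (z.2 < 2 * h z.1)%R] z)%:E < +oo)%E in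
  [/\ (S1 -> S2) /\ (S2 -> S3),
      S3 -> S4 -> S5 -> S1
    & S6 -> S4 /\ S5].
Proof.
move=> S1 S2 S3 S4 S5 S6; split.
- split; last exact: limsup_lt1_above_fin.
  by apply: filterS => w ->; exact: lte01.
- exact: above_fin_limsup_eq0.
- move=> fin6; split; first exact: ratio_integral_ratio2.
  exact: ratio_integral_mean_cvg0.
Qed.
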